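(* Let $\mathcal F:\mathbb R^n\to\mathbb R^m$ be a measurable forward model, $\boldsymbol C_\varepsilon\in\mathbb R^{m\times m}$ symmetric positive definite, $\pi$ a prior probability density on $\mathbb R^n$, $Y\in\mathbb R^m$ fixed data, and $\boldsymbol\Pi_r\in\mathbb R^{n\times n}$ a linear projector of rank $r$, $1\le r<n$. Let $P$ be the posterior, $P_{\Pi_r}$ the approximate posterior built with the marginalized likelihood $\mathcal L_{\Pi_r}$, and $\omega=\mathcal L/\mathcal L_{\Pi_r}$ the corresponding weights (all defined in the context). Then the squared Hellinger distance between the posterior and its approximation is $$d_H(P,P_{\Pi_r})^2=1-\sqrt{1-\mathrm{Var}_{P_{\Pi_r}}\left(\sqrt{\omega(X)}\right)} .$$
   Context: Observation model: $Y=\mathcal F(X)+\boldsymbol\varepsilon$ with $\boldsymbol\varepsilon\sim\mathcal N(0,\boldsymbol C_\varepsilon)$. Likelihood: $\mathcal L(\boldsymbol x)=(2\pi)^{-m/2}\det(\boldsymbol C_\varepsilon)^{-1/2}\exp\left(-\tfrac12(\mathcal F(\boldsymbol x)-Y)^\top\boldsymbol C_\varepsilon^{-1}(\mathcal F(\boldsymbol x)-Y)\right)$. Posterior density: $P(\boldsymbol x)=\mathcal L(\boldsymbol x)\pi(\boldsymbol x)/\pi_{\mathrm{data}}$ with $\pi_{\mathrm{data}}=\int_{\mathbb R^n}\mathcal L(\boldsymbol x)\pi(\boldsymbol x)\,d\boldsymbol x$. Decomposition: $\boldsymbol V_r\in\mathbb R^{n\times r}$ and $\boldsymbol V_\perp\in\mathbb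 R^{n\times(n-r)}$ have columns forming bases of $\mathrm{Im}(\boldsymbol\Pi_r)$ and $\mathrm{Ker}(\boldsymbol\Pi_r)$ respectively. Every $\boldsymbol x\in\mathbb R^n$ is written uniquely as $\boldsymbol x=\boldsymbol V_r\boldsymbol z_r+\boldsymbol V_\perp\boldsymbol z_\perp$, with $\boldsymbol V_r\boldsymbol z_r=\boldsymbol\Pi_r\boldsymbol x$ and $\boldsymbol V_\perp\boldsymbol z_\perp=(\mathrm I_n-\boldsymbol\Pi_r)\boldsymbol x$. For $X\sim\pi$, $\pi_{\perp|r}(\cdot|\boldsymbol z_r)$ denotes the conditional density of $Z_\perp$ given $Z_r=\boldsymbol z_r$. Approximate likelihood: $\mathcal L_{\Pi_r}(\boldsymbol z_r)=\int_{\mathbb R^{n-r}}\mathcal L(\boldsymbol V_r\boldsymbol z_r+\boldsymbol V_\perp\boldsymbol z_\perp)\,\pi_{\perp|r}(\boldsymbol z_\perp|\boldsymbol z_r)\,d\boldsymbol z_\perp$. Approximate posterior density: $P_{\Pi_r}(\boldsymbol x)=\mathcal L_{\Pi_r}(\boldsymbol z_r)\pi(\boldsymbol x)/\pi_{\mathrm{data}}$ (the normalization constant is the same as that of $P$). Weights: $\omega(\boldsymbol x)=P(\boldsymbol x)/P_{\Pi_r}(\boldsymbol x)=\mathcal L(\boldsymbol x)/\mathcal L_{\Pi_r}(\boldsymbol z_r)$. Hellinger distance between probability densities $p,q$ on $\mathbb R^n$: $d_H(p,q)^2=\tfrac12\int_{\mathbb R^n}\left(\sqrt{p(\boldsymbol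 x)}-\sqrt{q(\boldsymbol x)}\right)^2d\boldsymbol x$. $\mathrm{Var}_{P_{\Pi_r}}$ denotes the variance when $X\sim P_{\Pi_r}$. *)

(* Defs.v *)
From HB Require Import structures.
From mathcomp Require Import all_boot all_order all_algebra.
From mathcomp Require Import all_classical all_reals all_analysis.
From mathcomp Require Import measurable_realfun.

Set Implicit Arguments.
Unset Strict Implicit.
Unset Printing Implicit Defensive.

Import Order.TTheory GRing.Theory Num.Theory.
Import numFieldNormedType.Exports.

Local Open Scope classical_set_scope.
Local Open Scope ring_scope.

(* Matrices carry the sigma-algebra generated by their entries (the Borel
   sigma-algebra of R^(m x n)). *)
Definition measure_matrix_display : measure_display.
Proof. exact: default_measure_display. Qed.

Section measurable_matrix.
Context {R : realType} (m n : nat).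

Definition entry_sets : set (set 'M[R]_(m, n)) :=
  [set B | exists i j, exists2 A : set R,
     measurable A & B = [set M : 'M[R]_(m, n) | A (M i j)]].

Let mx_set0 : <<s entry_sets >> set0.
Proof. exact: sigma_algebra0. Qed.

Let mx_setC A : <<s entry_sets >> A -> <<s entry_sets >> (~` A).
Proof. exact: sigma_algebraC. Qed.

Let mx_bigcup (F : (set 'M[R]_(m, n))^nat) :
  (forall i, <<s entry_sets >> (F i)) -> <<s entry_sets >> (\bigcup_i F i).
Proof. exact: sigma_algebra_bigcup. Qed.

HB.instance Definition _ := @isMeasurable.Build measure_matrix_display
  'M[R]_(m, n) <<s entry_sets >> mx_set0 mx_setC mx_bigcup.

End measurable_matrix.

Lemma measurable_entry (R : realType) m n (i : 'I_m) (j : 'I_n) :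
  measurable_fun setT (fun M : 'M[R]_(m, n) => M i j).
Proof.
move=> _ A mA; rewrite setTI; apply: sub_sigma_algebra.
by exists i, j, A.
Qed.

Lemma measurable_mxP d (T : measurableType d) (R : realType) m n
    (f : T -> 'M[R]_(m, n)) :
  (forall i j, measurable_fun setT (fun x => f x i j)) <->
  measurable_fun setT f.
Proof.
split=> [mf|mf i j]; last exact: (measurableT_comp (measurable_entry i j)).
apply: (measurability (@entry_sets R m n)) => //.
by move=> _ [_ [i [j [A mA ->]]] <-]; exact: mf.
Qed.

Section lebesgue_vector.
Context {R : realType}.

Definition ccons n (av : measurableTypeR R * 'cV[R]_n) : 'cV[R]_n.+1 :=
  \col_i (if unlift ord0 i is Some j then av.2 j ord0 else av.1).

Definition cuncons n (v : 'cV[R]_n.+1) : measurableTypeR R * 'cV[R]_n :=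
  (v ord0 ord0, \col_j v (lift ord0 j) ord0).

Lemma cconsK n : cancel (@ccons n) (@cuncons n).
Proof.
move=> [a v]; rewrite /cuncons !mxE unlift_none; congr pair.
by apply/colP => j; rewrite !mxE liftK.
Qed.

Lemma measurable_ccons n : measurable_fun setT (@ccons n).
Proof.
apply/measurable_mxP => i j; rewrite /ccons.
under eq_fun do rewrite mxE.
case: unlift => [k|].
  exact: (measurableT_comp (measurable_entry k ord0)).
exact: (@measurable_fst _ _ (measurableTypeR R)).
Qed.

Lemma measurable_cuncons n : measurable_fun setT (@cuncons n).
Proof.
apply/measurable_fun_pairP; split; first exact: measurable_entry.
apply/measurable_mxP => i j /=.
under eq_fun do rewrite mxE.
exact: measurable_entry.
Qed.

Section step.
Variables (n : nat) (mu : {sigma_finite_measure set 'cV[R]_n -> \bar R}).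

(* The image of the product of lebesgue_measure and mu under
   (a, v) |-> (a, v_0, ..., v_(n-1)). *)
Definition leb_step : set 'cV[R]_n.+1 -> \bar R :=
  pushforward (lebesgue_measure \x mu)%E (@ccons n).

Let leb_step0 : leb_step set0 = 0%E.
Proof. by rewrite /leb_step /pushforward preimage_set0 measure0. Qed.

Let leb_step_ge0 A : (0 <= leb_step A)%E.
Proof. exact: integral_ge0. Qed.

Let leb_step_sigma_additive : semi_sigma_additive leb_step.
Proof.
have mc A : measurable A -> measurable (@ccons n @^-1` A).
  by move=> mA; rewrite -[X in measurable X]setTI; exact: measurable_ccons.
move=> A mA tA mUA; rewrite /leb_step /pushforward preimage_bigcup.
apply: measure_semi_sigma_additive.
- by move=> i; exact: mc.
- apply/trivIsetP => i j _ _ ij; rewrite -preimage_setI.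
  by move/trivIsetP : tA => /(_ _ _ _ _ ij) -> //; rewrite preimage_set0.
- by rewrite -preimage_bigcup; exact: mc.
Qed.

HB.instance Definition _ := isMeasure.Build _ _ _ leb_step
  leb_step0 leb_step_ge0 leb_step_sigma_additive.

Let leb_step_sigma_finite : sigma_finite setT leb_step.
Proof.
have /sigma_finiteP[F [TF ndF Foo]] := sigma_finiteT (@lebesgue_measure R).
have /sigma_finiteP[G [TG ndG Goo]] := sigma_finiteT mu.
exists (fun k => @cuncons n @^-1` (F k `*` G k)).
  rewrite -preimage_bigcup (_ : \bigcup_k _ = setT) ?preimage_setT//.
  rewrite -subTset => -[a v] _.
  have [i _ Fa] : (\bigcup_k F k) a by rewrite -TF.
  have [j _ Gv] : (\bigcup_k G k) v by rewrite -TG.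
  exists (maxn i j) => //; split.
  - by move: a Fa {Gv}; exact/subsetPset/ndF/leq_maxl.
  - by move: v Gv {Fa}; exact/subsetPset/ndG/leq_maxr.
move=> k; have [mF Fk] := Foo k; have [mG Gk] := Goo k; split.
  rewrite -[X in measurable X]setTI.
  by apply: measurable_cuncons => //; exact: measurableX.
rewrite /leb_step /pushforward -comp_preimage.
rewrite (_ : _ \o _ = id); last by apply/funext => x /=; rewrite cconsK.
by rewrite preimage_id product_measure1E// lte_mul_pinfty// ge0_fin_numE.
Qed.

HB.instance Definition _ :=
  Measure_isSigmaFinite.Build _ _ _ leb_step leb_step_sigma_finite.

End step.

(* Lebesgue measure on R^n. *)
Fixpoint leb (n : nat) : {sigma_finite_measure set 'cV[R]_n -> \bar R} :=
  match n with
  | 0 => dirac (0 : 'cV[R]_0)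
  | n'.+1 => leb_step (leb n')
  end.

End lebesgue_vector.
Arguments leb {R} n.

Section densities.
Context {R : realType} (n : nat).
Implicit Types p q f : 'cV[R]_n -> R.

Definition is_pdf p : Prop :=
  [/\ measurable_fun setT p, forall x, 0 <= p x
    & (\int[leb n]_x (p x)%:E = 1)%E].

(* The distribution of X when X has density p; for p that is not a probability
   density it is, by convention, a Dirac mass. *)
Definition law p : set 'cV[R]_n -> \bar R := fun A =>
  if `[< is_pdf p >] then (\int[leb n]_(x in A) (p x)%:E)%E
  else dirac (0 : 'cV[R]_n) A.

Section law_probability.
Variable p : 'cV[R]_n -> R.

Let law0 : law p set0 = 0%E.
Proof. by rewrite /law; case: asboolP => _; rewrite ?integral_set0 ?measure0. Qed.

Let law_ge0 A : (0 <= law p A)%E.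
Proof.
rewrite /law; case: asboolP => [[_ p0 _]|_]; last exact: measure_ge0.
by apply: integral_ge0 => x _; rewrite lee_fin.
Qed.

Let law_sigma_additive : semi_sigma_additive (law p).
Proof.
rewrite /law; case: asboolP => [[mp p0 _]|_].
  move=> A mA tA mUA; rewrite ge0_integral_bigcup//; last 2 first.
  - by apply: measurable_funTS; exact: measurableT_comp.
  - by move=> x _; rewrite lee_fin.
  apply: is_cvg_ereal_nneg_natsum_cond => i _ _.
  by apply: integral_ge0 => x _; rewrite lee_fin.
exact: measure_semi_sigma_additive.
Qed.

HB.instance Definition _ := isMeasure.Build _ _ _ (law p)
  law0 law_ge0 law_sigma_additive.

Let law_setT : law p setT = 1%E.
Proof. by rewrite /law; case: asboolP => [[]//|_]; rewrite diracT. Qed.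

HB.instance Definition _ := Measure_isProbability.Build _ _ _ (law p) law_setT.

End law_probability.

Lemma lawE p A : is_pdf p -> law p A = (\int[leb n]_(x in A) (p x)%:E)%E.
Proof. by rewrite /law; case: asboolP. Qed.

Definition hellinger p q : R :=
  Num.sqrt (2^-1 * \int[leb n]_x (Num.sqrt (p x) - Num.sqrt (q x)) ^+ 2).

End densities.

(* kappa z is a conditional density of W given Z = z under P, i.e.
   P(Z \in A, W \in B) = E[ 1_A(Z) * \int_B kappa(Z, w) dw ] for all Borel A, B.
   This determines kappa only up to a null set; in particular kappa z has
   integral 1 for almost every z with respect to the distribution of Z. *)
Definition is_conditional_density d (T : measurableType d) (R : realType)
    (k l : nat) (P : probability T R) (Z : T -> 'cV[R]_k) (W : T -> 'cV[R]_l)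
    (kappa : 'cV[R]_k -> 'cV[R]_l -> R) : Prop :=
  [/\ measurable_fun setT (fun zw : 'cV[R]_k * 'cV[R]_l => kappa zw.1 zw.2),
      forall z w, 0 <= kappa z w
    & forall A B, measurable A -> measurable B ->
        (P (Z @^-1` A `&` W @^-1` B) =
         \int[P]_(x in Z @^-1` A) \int[leb l]_(w in B) (kappa (Z x) w)%:E)%E].

Section linear_algebra.
Context {R : realType}.

Definition is_spd m (C : 'M[R]_m) : Prop :=
  C^T = C /\ forall v : 'cV[R]_m, v != 0 -> 0 < (v^T *m C *m v) ord0 ord0.

(* The columns of V form a basis of the subspace S. *)
Definition is_column_basis n k (V : 'M[R]_(n, k)) (S : set 'cV[R]_n) : Prop :=
  row_free V^T /\ range (fun z : 'cV[R]_k => V *m z) = S.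

(* Coordinates of y in the basis given by the columns of V. *)
Definition coordinates n k (V : 'M[R]_(n, k)) (y : 'cV[R]_n) : 'cV[R]_k :=
  pinvmx V *m y.

Lemma mulmxK_coordinates n k (V : 'M[R]_(n, k)) S (z : 'cV[R]_k) :
  is_column_basis V S -> coordinates V (V *m z) = z.
Proof.
move=> [Vfree _]; rewrite /coordinates mulmxA mulVpmx ?mul1mx//.
by rewrite /row_full -mxrank_tr.
Qed.

Lemma coordinatesK n k (V : 'M[R]_(n, k)) S y :
  is_column_basis V S -> S y -> V *m coordinates V y = y.
Proof.
move=> VS; have [_ <-] := VS => -[z _ <-].
by rewrite (mulmxK_coordinates z VS).
Qed.

End linear_algebra.

Section posterior.
Context {R : realType} (n m : nat).
Variables (F : 'cV[R]_n -> 'cV[R]_m) (C : 'M[R]_m) (Y : 'cV[R]_m).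
Variable prior : 'cV[R]_n -> R.

Definition likelihood (x : 'cV[R]_n) : R :=
  (2 * pi) `^ (- (m%:R / 2)) * (\det C) `^ (- 2^-1) *
  expR (- 2^-1 * ((F x - Y)^T *m invmx C *m (F x - Y)) ord0 ord0).

Definition pi_data : R := \int[leb n]_x (likelihood x * prior x).

Definition posterior (x : 'cV[R]_n) : R := likelihood x * prior x / pi_data.

Variables (r : nat) (Pi : 'M[R]_n).
Variables (Vr : 'M[R]_(n, r)) (Vp : 'M[R]_(n, n - r)).

(* x = Vr *m z_r x + Vp *m z_perp x *)
Definition z_r (x : 'cV[R]_n) : 'cV[R]_r := coordinates Vr (Pi *m x).

Definition z_perp (x : 'cV[R]_n) : 'cV[R]_(n - r) :=
  coordinates Vp ((1%:M - Pi) *m x).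

(* pi_perp z_r is the conditional density of z_perp X given z_r X = z_r,
   for X distributed according to the prior. *)
Variable pi_perp : 'cV[R]_r -> 'cV[R]_(n - r) -> R.

Definition approx_likelihood (zr : 'cV[R]_r) : R :=
  \int[leb (n - r)]_zp (likelihood (Vr *m zr + Vp *m zp) * pi_perp zr zp).

Definition approx_posterior (x : 'cV[R]_n) : R :=
  approx_likelihood (z_r x) * prior x / pi_data.

Definition weight (x : 'cV[R]_n) : R := likelihood x / approx_likelihood (z_r x).

End posterior.

Lemma z_decomposition (R : realType) n r (Pi : 'M[R]_n)
    (Vr : 'M[R]_(n, r)) (Vp : 'M[R]_(n, n - r)) (x : 'cV[R]_n) :
    Pi *m Pi = Pi ->
    is_column_basis Vr (range (fun x : 'cV[R]_n => Pi *m x)) ->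
    is_column_basis Vp [set x : 'cV[R]_n | Pi *m x = 0] ->
  Vr *m z_r Pi Vr x = Pi *m x /\ Vp *m z_perp Pi Vp x = (1%:M - Pi) *m x.
Proof.
move=> PiPi hVr hVp; split.
  by rewrite /z_r (coordinatesK hVr)//; exists x.
by rewrite /z_perp (coordinatesK hVp)//= mulmxA mulmxBr mulmx1 PiPi subrr mul0mx.
Qed.

(* Main.v *)
Require Import Defs.
From HB Require Import structures.
From mathcomp Require Import all_boot all_order all_algebra.
From mathcomp Require Import all_classical all_reals all_analysis.
From mathcomp Require Import measurable_realfun ring lra.

Set Implicit Arguments.
Unset Strict Implicit.
Unset Printing Implicit Defensive.

Import Order.TTheory GRing.Theory Num.Theory.
Import numFieldNormedType.Exports.

Local Open Scope classical_set_scope.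
Local Open Scope ring_scope.

(** The squared Hellinger distance of two densities [p] and [q] is one minus
    their affinity, the integral of [sqrt (p * q)] (lemma [hellinger_affinity]).
    If [p = w * q] almost everywhere, then under the law with density [q] the
    function [w] has mean 1 and [sqrt w] has mean the affinity, so the variance
    of [sqrt w] is one minus the squared affinity; the affinity is nonnegative,
    hence the formula (lemma [hellinger_variance]).

    It remains to see that the posterior and its approximation are probability
    densities whose ratio is the weight. The approximate likelihood [a] is the
    conditional expectation of the likelihood [L] given [Z], the coordinates of
    the projected parameter: for every nonnegative [g], [L * g Z] and
    [a Z * g Z] have the same prior mean (lemma
    [ge0_integral_conditional_mean], from the disintegration formula for the
    conditional density). With [g = 1], both unnormalized densities have
    integral [pi_data]. With [g] the indicator of the zeros of [a], the prior
    mass of the event [a Z = 0] vanishes, because [L] is positive; outside of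
    it [L = (L / a) * a] and the weight is the ratio of the two densities. *)

(** * Integration against a measure with a density *)

Section density.
Local Open Scope ereal_scope.
Context d (T : measurableType d) (R : realType).
Variables (mu nu : {measure set T -> \bar R}) (p : T -> R).
Hypotheses (mp : measurable_fun setT p) (p0 : forall x, (0 <= p x)%R).
Hypothesis nuE :
  forall A, measurable A -> nu A = \int[mu]_(x in A) (p x)%:E.

Import HBNNSimple.

Let density_nnsfun (h : {nnsfun T >-> R}) :
  \int[nu]_x (h x)%:E = \int[mu]_x ((h x)%:E * (p x)%:E).
Proof.
have mEp : measurable_fun setT (EFin \o p) by exact: measurableT_comp.
under [LHS]eq_integral do rewrite fimfunE -fsumEFin//.
rewrite ge0_integral_fsum//; last 2 first.
  - by move=> r; exact/measurable_EFinP/measurableT_comp.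
  - by move=> r x _; exact: nnfun_muleindic_ge0.
under [RHS]eq_integral.
  move=> x _; rewrite fimfunE -fsumEFin// ge0_mule_fsuml; last first.
    by move=> r; exact: nnfun_muleindic_ge0.
  over.
rewrite ge0_integral_fsum//; last 2 first.
  - move=> r; apply: emeasurable_funM => //.
    by apply/measurable_EFinP/measurableT_comp.
  - by move=> r x _; rewrite mule_ge0 ?lee_fin//; exact: nnfun_muleindic_ge0.
apply: eq_fsbigr => r; rewrite inE => -[t _ <-].
rewrite integralZl_indic_nnsfun//= integral_indic//= setIT nuE//.
under [RHS]eq_integral do rewrite EFinM -muleA.
rewrite ge0_integralZl//; last 3 first.
  - by apply: emeasurable_funM => //; exact/measurable_EFinP.
  - by move=> x _; rewrite mule_ge0 ?lee_fin.
  - by rewrite lee_fin.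
congr (_ * _); rewrite integral_mkcond; apply: eq_integral => x _.
by rewrite epatch_indic muleC.
Qed.

Lemma ge0_integral_density (f : T -> \bar R) :
  measurable_fun setT f -> (forall x, 0 <= f x) ->
  \int[nu]_x f x = \int[mu]_x (f x * (p x)%:E).
Proof.
move=> mf f0; pose h := nnsfun_approx measurableT mf.
have fE x : f x = lim ((h n x)%:E @[n --> \oo]).
  by apply/esym/cvg_lim => //; exact: cvg_nnsfun_approx.
under [LHS]eq_integral do rewrite fE.
rewrite monotone_convergence//; last 3 first.
  - by move=> n; exact/measurable_EFinP.
  - by move=> n x _; rewrite lee_fin.
  - by move=> x _ a b ab; rewrite lee_fin; exact/lefP/nd_nnsfun_approx.
under [RHS]eq_integral.
  move=> x _; rewrite (_ : _ * _ = lim ((h n x)%:E * (p x)%:E @[n --> \oo])).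
    over.
  by apply/esym/cvg_lim => //; apply: cvgeZr => //; exact: cvg_nnsfun_approx.
rewrite monotone_convergence//; last 3 first.
  - by move=> n; apply: emeasurable_funM; exact/measurable_EFinP.
  - by move=> n x _; rewrite mule_ge0 ?lee_fin.
  - move=> x _ a b ab; rewrite lee_wpmul2r ?lee_fin//.
    exact/lefP/nd_nnsfun_approx.
by apply/congr_lim/funext => n; exact: density_nnsfun.
Qed.

End density.

(** * Conditional densities and conditional means *)

Section conditional_density.
Local Open Scope ereal_scope.
Context d (T : measurableType d) (R : realType) (k l : nat).
Variables (P : probability T R) (Z : T -> 'cV[R]_k) (W : T -> 'cV[R]_l).
Variable kappa : 'cV[R]_k -> 'cV[R]_l -> R.
Hypotheses (mZ : measurable_fun setT Z) (mW : measurable_fun setT W).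
Hypothesis kappaP : is_conditional_density P Z W kappa.

(** The defining property of a conditional density, extended from rectangles to
    nonnegative functions. The law of [(Z, W)] and the measure with density
    [kappa] with respect to the product of the law of [Z] and Lebesgue measure
    agree on rectangles, hence everywhere; Tonelli's theorem concludes. *)
Lemma disintegration (f : 'cV[R]_k * 'cV[R]_l -> \bar R) :
    measurable_fun setT f -> (forall zw, 0 <= f zw) ->
  \int[P]_x f (Z x, W x) =
  \int[P]_x \int[leb l]_w (f (Z x, w) * (kappa (Z x) w)%:E).
Proof.
move=> mf f0; have [mkappa kappa0 kappaE] := kappaP.
pose Zm : {mfun T >-> 'cV[R]_k} :=
  HB.pack Z (isMeasurableFun.Build _ _ _ _ Z mZ).
pose ZW x := (Z x, W x).
have mZW : measurable_fun setT ZW by exact/measurable_fun_pairP.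
pose ZWm : {mfun T >-> ('cV[R]_k * 'cV[R]_l)%type} :=
  HB.pack ZW (isMeasurableFun.Build _ _ _ _ ZW mZW).
pose PZ : probability _ R := distribution P Zm.
pose PZW : probability _ R := distribution P ZWm.
pose mu := (PZ \x leb l)%E.
pose q (zw : 'cV[R]_k * 'cV[R]_l) : R := kappa zw.1 zw.2.
pose nu A := \int[mu]_(zw in A) (q zw)%:E.
have mq : measurable_fun setT (EFin \o q) by exact: measurableT_comp.
have q0 zw : 0 <= (q zw)%:E by rewrite lee_fin; exact: kappa0.
have nu0 : nu set0 = 0 by rewrite /nu integral_set0.
have nu_ge0 A : 0 <= nu A by apply: integral_ge0 => zw _; exact: q0.
have nu_sigma_additive : semi_sigma_additive nu.
  move=> A mA tA mUA; rewrite /nu ge0_integral_bigcup//; last first.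
    exact: measurable_funTS.
  by apply: is_cvg_ereal_nneg_natsum_cond => i _ _; exact: nu_ge0.
pose num : {measure set _ -> \bar R} :=
  HB.pack nu (isMeasure.Build _ _ _ nu nu0 nu_ge0 nu_sigma_additive).
have PZWE A : measurable A -> PZW A = nu A.
  (* Uniqueness on the pi-system of measurable rectangles; the total space is
     a rectangle of finite mass. *)
  apply: (measure_unique
      [set A `*` B | A in measurable & B in measurable] (fun=> setT)
      _ _ _ _ PZW num).
  - by rewrite measurable_prod_measurableType.
  - move=> _ _ [A1 mA1 [B1 mB1 <-]] [A2 mA2 [B2 mB2 <-]].
    exists (A1 `&` A2); first exact: measurableI.
    by exists (B1 `&` B2); [exact: measurableI|rewrite setXI].
  - by move=> _; exists setT => //; exists setT => //; rewrite setXTT.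
  - by rewrite bigcup_const.
  - move=> _ [A1 mA1 [B1 mB1 <-]].
    rewrite /num /PZW /= /distribution /pushforward /=.
    rewrite (_ : ZW @^-1` _ = Z @^-1` A1 `&` W @^-1` B1)//.
    rewrite kappaE// /nu [RHS]integral_mkcond /mu.
    rewrite fubini_tonelli1//; last 2 first.
    + apply/(measurable_restrictT _ _).1; first exact: measurableX.
      exact: measurable_funTS.
    + by move=> zw; apply: erestrict_ge0.
    rewrite ge0_integral_distribution/=; last 2 first.
    + apply: measurable_fun_fubini_tonelli_F.
      * apply/(measurable_restrictT _ _).1; first exact: measurableX.
        exact: measurable_funTS.
      * by move=> zw; apply: erestrict_ge0.
    + by move=> z; apply: integral_ge0 => w _; apply: erestrict_ge0.
    rewrite integral_mkcond; apply: eq_integral => x _.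
    rewrite patchE /fubini_F /=; case: ifPn => xA.
      rewrite integral_mkcond; apply: eq_integral => w _.
      by rewrite !patchE in_setX/= (_ : Z x \in A1)//; rewrite inE in xA *.
    rewrite integral0_eq// => w _; rewrite patchE in_setX/= memNset//.
    by rewrite notin_setE in xA.
  - by move=> _; rewrite (le_lt_trans (probability_le1 PZW measurableT)) ?ltry.
transitivity (\int[PZW]_zw f zw).
  by rewrite ge0_integral_distribution.
rewrite (ge0_integral_density (mu := mu) (p := q))//.
have mfq : measurable_fun setT (fun zw => f zw * (q zw)%:E).
  exact: emeasurable_funM.
have fq0 zw : 0 <= f zw * (q zw)%:E by rewrite mule_ge0.
rewrite /mu fubini_tonelli1// ge0_integral_distribution//.
- exact: measurable_fun_fubini_tonelli_F.
- by move=> z; exact: integral_ge0.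
Qed.

Variable f : 'cV[R]_k * 'cV[R]_l -> R.
Hypotheses (mf : measurable_fun setT f) (f0 : forall zw, (0 <= f zw)%R).

(** The mean of [f (z, W)] for [W] with density [kappa z]. As a real-valued
    integral it is 0 at the points [z] where the integral diverges. *)
Definition conditional_mean z : R :=
  \int[leb l]_w (f (z, w) * kappa z w)%R.

Let mfk : measurable_fun setT (fun zw => (f zw * kappa zw.1 zw.2)%:E).
Proof. by have [mk _ _] := kappaP; apply/measurable_EFinP/measurable_funM. Qed.

Let fk0 zw : 0 <= (f zw * kappa zw.1 zw.2)%:E.
Proof. by have [_ k0 _] := kappaP; rewrite lee_fin mulr_ge0. Qed.

Lemma conditional_mean_ge0 z : (0 <= conditional_mean z)%R.
Proof. by apply: Rintegral_ge0 => w _; have := fk0 (z, w); rewrite lee_fin. Qed.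

Lemma measurable_conditional_mean : measurable_fun setT conditional_mean.
Proof.
apply: (measurableT_comp (fine_measurable measurableT)).
exact: (measurable_fun_fubini_tonelli_F (m2 := leb l) _ mfk fk0).
Qed.

(** [conditional_mean (Z x)] is the conditional expectation of [f (Z, W)] given
    [Z]. *)
Lemma ge0_integral_conditional_mean (g : 'cV[R]_k -> \bar R) :
    P.-integrable setT (fun x => (f (Z x, W x))%:E) ->
    measurable_fun setT g -> (forall z, 0 <= g z) ->
  \int[P]_x ((f (Z x, W x))%:E * g (Z x)) =
  \int[P]_x ((conditional_mean (Z x))%:E * g (Z x)).
Proof.
move=> fint mg g0.
pose a z : \bar R := \int[leb l]_w (f (z, w) * kappa z w)%:E.
have a0 z : 0 <= a z by apply: integral_ge0 => w _; exact: (fk0 (z, w)).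
have ma : measurable_fun setT a.
  exact: (measurable_fun_fubini_tonelli_F (m2 := leb l) _ mfk fk0).
have aE (h : 'cV[R]_k -> \bar R) : measurable_fun setT h ->
    (forall z, 0 <= h z) ->
    \int[P]_x ((f (Z x, W x))%:E * h (Z x)) = \int[P]_x (a (Z x) * h (Z x)).
  move=> mh h0.
  rewrite (disintegration (f := fun zw => (f zw)%:E * h zw.1)); last 2 first.
  - apply: emeasurable_funM; first exact/measurable_EFinP.
    exact: measurableT_comp.
  - by move=> zw; rewrite mule_ge0 ?lee_fin.
  apply: eq_integral => x _; rewrite /a -ge0_integralZr//.
  - by apply: eq_integral => w _; rewrite EFinM muleAC.
  - exact: (measurableT_comp mfk).
(* The extended-real conditional mean [a] is integrable, hence finite almost
   surely, so it agrees with its real-valued version. *)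
have aint : P.-integrable setT (a \o Z).
  apply/integrableP; split; first exact: measurableT_comp.
  have /integrableP[_] := fint; apply: le_lt_trans; rewrite le_eqVlt.
  apply/orP; left; apply/eqP.
  under [RHS]eq_integral do rewrite gee0_abs ?lee_fin// -[_%:E]mule1.
  rewrite (aE (cst 1))//; apply: eq_integral => x _.
  by rewrite mule1 gee0_abs//; exact: a0.
rewrite aE//; apply: ge0_ae_eq_integral => //.
- by apply: emeasurable_funM; exact: measurableT_comp.
- apply: emeasurable_funM; last exact: measurableT_comp.
  by apply/measurable_EFinP/measurableT_comp => //;
    exact: measurable_conditional_mean.
- by move=> x _; rewrite mule_ge0.
- by move=> x _; rewrite mule_ge0 ?lee_fin ?conditional_mean_ge0.
- apply: filterS (integrable_ae measurableT aint) => x /(_ I) /= ax _.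
  by rewrite /conditional_mean /Rintegral fineK.
Qed.

End conditional_density.

(** * Hellinger distance and variance of the root density ratio *)

Lemma measurable_sqrtr (R : realType) : measurable_fun setT (@Num.sqrt R).
Proof. by apply: continuous_measurable_fun; exact: sqrt_continuous. Qed.

Section law_integral.
Context {R : realType} (n : nat) (p : 'cV[R]_n -> R).
Hypothesis pP : is_pdf p.

Lemma pdf_integrable : (leb n).-integrable setT (EFin \o p).
Proof.
have [mp p0 p1] := pP; apply/integrableP; split; first exact/measurable_EFinP.
under eq_integral do rewrite /= ger0_norm//.
by rewrite p1 ltry.
Qed.

Lemma ge0_integral_law (f : 'cV[R]_n -> \bar R) :
    measurable_fun setT f -> (forall x, 0 <= f x)%E ->
  (\int[law p]_x f x = \int[leb n]_x (f x * (p x)%:E))%E.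
Proof.
have [mp p0 p1] := pP; apply: ge0_integral_density => // A mA; exact: lawE.
Qed.

End law_integral.

Section hellinger_variance.
Context {R : realType} (n : nat).
Variables (p q w : 'cV[R]_n -> R).
Hypotheses (pP : is_pdf p) (qP : is_pdf q).

Let mp : measurable_fun setT p. Proof. by case: pP. Qed.
Let p0 x : 0 <= p x. Proof. by case: pP. Qed.
Let mq : measurable_fun setT q. Proof. by case: qP. Qed.
Let q0 x : 0 <= q x. Proof. by case: qP. Qed.

(** The Hellinger affinity (Bhattacharyya coefficient) of [p] and [q]. *)
Definition affinity : R := \int[leb n]_x (Num.sqrt (p x) * Num.sqrt (q x)).

Lemma affinity_ge0 : 0 <= affinity.
Proof. by apply: Rintegral_ge0 => x _; rewrite mulr_ge0 ?sqrtr_ge0. Qed.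

(** By the inequality [2 * s * t <= s ^+ 2 + t ^+ 2]. *)
Lemma affinity_integrable :
  (leb n).-integrable setT
    (EFin \o (fun x => Num.sqrt (p x) * Num.sqrt (q x))).
Proof.
apply: (@le_integrable _ _ _ _ _ _ _ (EFin \o (p \+ q))) => //.
- apply/measurable_EFinP; apply: measurable_funM;
  by apply: measurableT_comp => //; exact: measurable_sqrtr.
- move=> x _; rewrite /= lee_fin !ger0_norm ?addr_ge0 ?mulr_ge0 ?sqrtr_ge0//.
  rewrite -{2}(sqr_sqrtr (p0 x)) -{2}(sqr_sqrtr (q0 x)).
  have := sqrtr_ge0 (p x); have := sqrtr_ge0 (q x); nra.
- by apply: (@integrableD _ _ _ _ _ _ (EFin \o p) (EFin \o q)) => //;
    exact: pdf_integrable.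
Qed.

Lemma hellinger_affinity : hellinger p q ^+ 2 = 1 - affinity.
Proof.
have pI := pdf_integrable pP; have qI := pdf_integrable qP.
have aI := affinity_integrable.
rewrite /hellinger sqr_sqrtr; last first.
  by rewrite mulr_ge0 ?invr_ge0// Rintegral_ge0// => x _; rewrite sqr_ge0.
under eq_Rintegral => x _.
  rewrite (_ : _ ^+ 2 = (p x + q x) -
      2 * (Num.sqrt (p x) * Num.sqrt (q x))); last first.
    by rewrite sqrrB !sqr_sqrtr// -mulr_natl; ring.
  over.
have p1 : \int[leb n]_x p x = 1 by case: pP => _ _; rewrite /Rintegral => ->.
have q1 : \int[leb n]_x q x = 1 by case: qP => _ _; rewrite /Rintegral => ->.
have pqI : (leb n).-integrable setT (EFin \o (fun x => p x + q x)).
  exact: (@integrableD _ _ _ _ _ _ (EFin \o p) (EFin \o q)).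
have a2I : (leb n).-integrable setT
    (EFin \o (fun x => 2 * (Num.sqrt (p x) * Num.sqrt (q x)))).
  exact: (integrableZl measurableT 2 aI).
rewrite RintegralB// RintegralD// RintegralZl// p1 q1 -/affinity.
by field.
Qed.

Hypotheses (mw : measurable_fun setT w) (w0 : forall x, 0 <= w x).
Hypothesis pwq : {ae leb n, forall x, p x = w x * q x}.

(** The hypothesis [pwq] makes [w] a version of the density of the law of [p]
    with respect to the law of [q]. *)
Lemma hellinger_variance :
  hellinger p q ^+ 2 =
  1 - Num.sqrt (1 - fine 'V_(law q)[fun x => Num.sqrt (w x)]).
Proof.
have [_ _ p1] := pP.
have Ew : (\int[law q]_x (w x)%:E = 1)%E.
  rewrite ge0_integral_law//; last exact/measurable_EFinP.
  rewrite -p1; apply: ge0_ae_eq_integral => //.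
  - by apply: emeasurable_funM; exact/measurable_EFinP.
  - exact/measurable_EFinP.
  - by move=> x _; rewrite mule_ge0 ?lee_fin.
  - by move=> x _; rewrite lee_fin.
  - by apply: filterS pwq => x -> _; rewrite EFinM.
have msw : measurable_fun setT (fun x => Num.sqrt (w x)).
  by apply: measurableT_comp => //; exact: measurable_sqrtr.
have Esw : (\int[law q]_x (Num.sqrt (w x))%:E = affinity%:E)%E.
  rewrite ge0_integral_law//; last exact/measurable_EFinP.
  rewrite /affinity /Rintegral fineK; last first.
    by apply: integrable_fin_num => //; exact: affinity_integrable.
  apply: ge0_ae_eq_integral => //.
  - by apply: emeasurable_funM; exact/measurable_EFinP.
  - by have /measurable_int := affinity_integrable.
  - by move=> x _; rewrite mule_ge0 ?lee_fin ?sqrtr_ge0.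
  - apply: filterS pwq => x -> _ /=.
    by rewrite -EFinM sqrtrM// -mulrA -expr2 sqr_sqrtr.
have wL : w \in Lfun (law q) 1.
  apply/Lfun1_integrable/integrableP; split; first exact/measurable_EFinP.
  by under eq_integral do rewrite /= ger0_norm//; rewrite Ew ltry.
have swL : (fun x => Num.sqrt (w x)) \in Lfun (law q) 1.
  apply/Lfun1_integrable/integrableP; split; first exact/measurable_EFinP.
  under eq_integral do rewrite /= ger0_norm ?sqrtr_ge0//.
  by rewrite Esw ltry.
have sqr_sw : ((fun x => Num.sqrt (w x)) * (fun x => Num.sqrt (w x)) = w)%R.
  by apply/funext => x /=; rewrite -[LHS]expr2 sqr_sqrtr.
rewrite hellinger_affinity /variance covarianceE ?sqr_sw// unlock Ew Esw.
by rewrite -EFinM -EFinB /= subKr -expr2 sqrtr_sqr ger0_norm ?affinity_ge0.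
Qed.

End hellinger_variance.

(** * The Gaussian likelihood *)

Section measurable_matrix_operations.
Context d (T : measurableType d) {R : realType}.

Lemma measurable_mulmx m n p (f : T -> 'M[R]_(m, n)) (g : T -> 'M[R]_(n, p)) :
  measurable_fun setT f -> measurable_fun setT g ->
  measurable_fun setT (fun x => f x *m g x).
Proof.
move=> /measurable_mxP mf /measurable_mxP mg; apply/measurable_mxP => i j.
under eq_fun do rewrite mxE.
elim: (index_enum _) => [|k s IHs].
  by under eq_fun do rewrite big_nil; exact: measurable_cst.
under eq_fun do rewrite big_cons.
by apply: measurable_funD => //; exact: measurable_funM.
Qed.

Lemma measurable_addmx m n (f g : T -> 'M[R]_(m, n)) :
  measurable_fun setT f -> measurable_fun setT g ->
  measurable_fun setT (fun x => f x + g x).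
Proof.
move=> /measurable_mxP mf /measurable_mxP mg; apply/measurable_mxP => i j.
by under eq_fun do rewrite mxE; exact: measurable_funD.
Qed.

Lemma measurable_trmx m n (f : T -> 'M[R]_(m, n)) :
  measurable_fun setT f -> measurable_fun setT (fun x => (f x)^T).
Proof.
move=> /measurable_mxP mf; apply/measurable_mxP => i j.
by under eq_fun do rewrite mxE; exact: mf.
Qed.

End measurable_matrix_operations.

Section spd.
Context {R : realType} (m : nat) (C : 'M[R]_m).
Hypothesis C_spd : is_spd C.

Lemma spd_unitmx : C \in unitmx.
Proof.
have [_ Cpos] := C_spd; rewrite -row_free_unit; apply: inj_row_free => v vC0.
apply/eqP; apply: contraT => v0.
have /Cpos : v^T != 0 by rewrite -trmx0 (inj_eq (@trmx_inj _ _ _)).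
by rewrite trmxK vC0 mul0mx mxE ltxx.
Qed.

Lemma spd_invmx_ge0 (u : 'cV[R]_m) : 0 <= (u^T *m invmx C *m u) ord0 ord0.
Proof.
have [Csym Cpos] := C_spd; have Cu := spd_unitmx.
pose v := invmx C *m u; have -> : u = C *m v by rewrite /v mulKVmx.
rewrite trmx_mul Csym mulmxK// mulmxA.
have [->|/Cpos /ltW//] := eqVneq v 0.
by rewrite mulmx0 mxE.
Qed.

End spd.

Section likelihood.
Context {R : realType} (n m : nat).
Variables (F : 'cV[R]_n -> 'cV[R]_m) (C : 'M[R]_m) (Y : 'cV[R]_m).
Hypotheses (mF : measurable_fun setT F) (C_spd : is_spd C).

Lemma measurable_likelihood : measurable_fun setT (likelihood F C Y).
Proof.
have mFY : measurable_fun setT (fun x => F x - Y).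
  by apply: measurable_addmx => //; exact: measurable_cst.
apply: measurable_funM; first exact: measurable_cst.
apply: (measurableT_comp (@measurable_expR R)).
apply: measurable_funM; first exact: measurable_cst.
move/measurable_mxP : (measurable_mulmx (measurable_mulmx (measurable_trmx mFY)
  (measurable_cst (invmx C))) mFY); exact.
Qed.

Lemma likelihood_gt0 x : 0 < likelihood F C Y x.
Proof.
(* A power of a nonzero real number is positive in all cases, since the
   logarithm of a negative number is 0 by convention. *)
have detC : \det C != 0 by have := spd_unitmx C_spd; rewrite unitmxE unitfE.
have detC_powR : 0 < (\det C) `^ (- 2^-1).
  by rewrite /powR (negbTE detC) expR_gt0.
apply: mulr_gt0 (expR_gt0 _); apply: mulr_gt0 detC_powR.
by rewrite powR_gt0// mulr_gt0// pi_gt0.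
Qed.

Lemma likelihood_le x : likelihood F C Y x <=
  (2 * pi) `^ (- (m%:R / 2)) * (\det C) `^ (- 2^-1).
Proof.
rewrite /likelihood ler_piMr ?mulr_ge0 ?powR_ge0// -expR0 ler_expR.
by rewrite mulNr oppr_le0 mulr_ge0// spd_invmx_ge0.
Qed.

End likelihood.

(** * The Hellinger distance between the posteriors *)

Lemma is_pdf_normalize (R : realType) n (f : 'cV[R]_n -> R) (c : R) :
    measurable_fun setT f -> (forall x, 0 <= f x) -> 0 < c ->
    (\int[leb n]_x (f x)%:E = c%:E)%E ->
  is_pdf (fun x => f x / c).
Proof.
move=> mf f0 c0 fc; split.
- by apply: measurable_funM => //; exact: measurable_cst.
- by move=> x; rewrite divr_ge0// ltW.
under eq_integral do rewrite EFinM.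
rewrite ge0_integralZr//; last 3 first.
- exact/measurable_EFinP.
- by move=> x _; rewrite lee_fin.
- by rewrite lee_fin invr_ge0 ltW.
by rewrite fc -EFinM divff// gt_eqF.
Qed.

Theorem mainTheorem2 (R : realType) (n m r : nat)
    (F : 'cV[R]_n -> 'cV[R]_m) (C : 'M[R]_m) (Y : 'cV[R]_m)
    (prior : 'cV[R]_n -> R) (Pi : 'M[R]_n)
    (Vr : 'M[R]_(n, r)) (Vp : 'M[R]_(n, n - r))
    (pi_perp : 'cV[R]_r -> 'cV[R]_(n - r) -> R)
    (F_measurable : measurable_fun setT F)
    (C_spd : is_spd C)
    (prior_pdf : is_pdf prior)
    (r_ge1 : (1 <= r)%N) (r_lt_n : (r < n)%N)
    (Pi_projector : Pi *m Pi = Pi) (Pi_rank : \rank Pi = r)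
    (Vr_basis : is_column_basis Vr (range (fun x : 'cV[R]_n => Pi *m x)))
    (Vp_basis : is_column_basis Vp [set x : 'cV[R]_n | Pi *m x = 0])
    (pi_perp_cond :
      is_conditional_density (law prior) (z_r Pi Vr) (z_perp Pi Vp) pi_perp) :
  let P := posterior F C Y prior in
  let P_Pi := approx_posterior F C Y prior Pi Vr Vp pi_perp in
  let omega := weight F C Y Pi Vr Vp pi_perp in
  hellinger P P_Pi ^+ 2 =
  1 - Num.sqrt (1 - fine 'V_(law P_Pi)[fun x => Num.sqrt (omega x)]).
Proof.
have [mprior prior0 prior1] := prior_pdf.
set L := likelihood F C Y; have mL : measurable_fun setT L.
  exact: measurable_likelihood.
have L0 x : 0 < L x by exact: likelihood_gt0.
pose Z := z_r Pi Vr; pose W := z_perp Pi Vp.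
have mZ : measurable_fun setT Z.
  by do 2 (apply: measurable_mulmx; first exact: measurable_cst).
have mW : measurable_fun setT W.
  by do 2 (apply: measurable_mulmx; first exact: measurable_cst).
pose f (zw : 'cV[R]_r * 'cV[R]_(n - r)) := L (Vr *m zw.1 + Vp *m zw.2).
have mf : measurable_fun setT f.
  apply: measurableT_comp => //.
  by apply: measurable_addmx; apply: measurable_mulmx => //;
    exact: measurable_cst.
have f0 zw : 0 <= f zw by exact/ltW/L0.
have fE x : f (Z x, W x) = L x.
  have [Zx Wx] := z_decomposition x Pi_projector Vr_basis Vp_basis.
  by rewrite /f /= /Z /W Zx Wx -mulmxDl addrC subrK mul1mx.
set a := approx_likelihood F C Y Vr Vp pi_perp.
have aE : a = conditional_mean pi_perp f by [].
have ma : measurable_fun setT a.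
  by rewrite aE; exact: measurable_conditional_mean pi_perp_cond _ _ _.
have a0 z : 0 <= a z.
  by rewrite aE; exact: conditional_mean_ge0 pi_perp_cond _ _ _.
(* The likelihood is bounded, hence integrable under the prior. *)
have LpI : (leb n).-integrable setT (EFin \o (fun x => L x * prior x)).
  pose c : R := (2 * pi) `^ (- (m%:R / 2)) * (\det C) `^ (- 2^-1).
  apply: (le_integrable _ _ _ (integrableZl measurableT c
    (pdf_integrable prior_pdf))) => //.
    by apply/measurable_EFinP; exact: measurable_funM.
  move=> x _; rewrite /= lee_fin ger0_norm; last by rewrite mulr_ge0// ltW.
  by rewrite (le_trans _ (ler_norm _))// ler_wpM2r// likelihood_le.
have LI : (law prior).-integrable setT (fun x => (f (Z x, W x))%:E).
  under eq_fun do rewrite fE.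
  apply/integrableP; split; first exact/measurable_EFinP.
  have /integrableP[_] := LpI; rewrite ge0_integral_law//; last first.
    by apply: measurableT_comp => //; exact/measurable_EFinP.
  under eq_integral do rewrite /= normrM (ger0_norm (prior0 _)) EFinM.
  by [].
(* [a Z] is the conditional expectation of [L] given [Z]. *)
have aP (g : 'cV[R]_r -> R) : measurable_fun setT g -> (forall z, 0 <= g z) ->
    (\int[leb n]_x (L x * g (Z x) * prior x)%:E =
     \int[leb n]_x (a (Z x) * g (Z x) * prior x)%:E)%E.
  move=> mg g0.
  have mEg : measurable_fun setT (EFin \o g) by exact/measurable_EFinP.
  have mgZ : measurable_fun setT (g \o Z) by exact: measurableT_comp.
  have maZ : measurable_fun setT (a \o Z) by exact: measurableT_comp.
  have gE0 z : (0 <= (g z)%:E)%E by rewrite lee_fin.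
  have := ge0_integral_conditional_mean mZ mW pi_perp_cond mf f0 LI mEg gE0.
  under eq_integral do rewrite fE; rewrite -aE.
  rewrite !ge0_integral_law//.
  - by apply/measurable_EFinP/measurable_funM.
  - by move=> x; rewrite mule_ge0// lee_fin.
  - by apply/measurable_EFinP/measurable_funM.
  - by move=> x; rewrite mule_ge0// lee_fin// ltW.
set D := pi_data F C Y prior.
have LpD : (\int[leb n]_x (L x * prior x)%:E = D%:E)%E.
  by rewrite /D /pi_data /Rintegral fineK// integrable_fin_num.
have Lp0 x : 0 <= L x * prior x by rewrite mulr_ge0// ltW.
have mLp : measurable_fun setT (fun x => L x * prior x).
  exact: measurable_funM.
have map_ : measurable_fun setT (fun x => a (Z x) * prior x).
  by apply: measurable_funM => //; exact: measurableT_comp.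
(* Otherwise [L * prior], hence the prior, would vanish almost everywhere. *)
have D0 : 0 < D.
  rewrite lt_neqAle eq_sym; apply/andP; split; last first.
    by apply: Rintegral_ge0 => x _.
  apply/eqP => D0; have : (\int[leb n]_x (prior x)%:E = 0)%E.
    apply/eqP; rewrite -(@integral0 _ _ _ (leb n) setT); apply/eqP.
    apply: ge0_ae_eq_integral => //.
    - exact/measurable_EFinP.
    - by move=> x _; rewrite lee_fin.
    have : (\int[leb n]_x `|(L x * prior x)%:E| = 0)%E.
      by under eq_integral do rewrite gee0_abs ?lee_fin//; rewrite LpD D0.
    move/ae_eq_integral_abs => /(_ measurableT).
    have mELp : measurable_fun setT (EFin \o (fun x => L x * prior x)).
      exact/measurable_EFinP.
    move/(_ mELp); apply: filterS => x /(_ I) /= [/eqP].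
    by rewrite mulf_eq0 gt_eqF//= => /eqP ->.
  by rewrite prior1 => /eqP; rewrite onee_eq0.
have apD : (\int[leb n]_x (a (Z x) * prior x)%:E = D%:E)%E.
  have := aP (cst 1) (measurable_cst _) (fun=> ler01).
  under eq_integral do rewrite /= mulr1.
  rewrite LpD => ->; by under [RHS]eq_integral do rewrite /= mulr1.
have P_pdf : is_pdf (posterior F C Y prior) by exact: is_pdf_normalize.
have Q_pdf : is_pdf (approx_posterior F C Y prior Pi Vr Vp pi_perp).
  by apply: is_pdf_normalize => // x; rewrite mulr_ge0.
move=> P Q omega; apply: hellinger_variance => //.
- apply: measurable_funM => //.
  (* The inverse is a real power on nonnegative numbers. *)
  rewrite (_ : (fun x => _) = fun x => a (Z x) `^ (-1)); last first.
    by apply/funext => x; rewrite powR_inv1.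
  apply: (measurableT_comp (measurable_powR _)).
  exact: measurableT_comp.
- by move=> x; apply: divr_ge0; [exact/ltW/L0|exact: a0].
(* The product [L * prior] vanishes almost everywhere on the event [a Z = 0],
   where the weight is [L / 0 = 0] and does not recover [L] from [a Z]. *)
pose N := [set z | a z = 0].
have mN : measurable N.
  by rewrite -[N]setTI; exact: (ma measurableT _ (measurable_set1 0)).
have LN0 : (\int[leb n]_x `|(L x * \1_N (Z x) * prior x)%:E| = 0)%E.
  have LN_ge0 x : 0 <= L x * \1_N (Z x) * prior x.
    by rewrite mulr_ge0// mulr_ge0 ?indicE// ltW.
  under eq_integral do rewrite gee0_abs ?lee_fin//.
  rewrite aP//; apply: integral0_eq => x _.
  rewrite indicE; case: (boolP (_ \in _)) => [|_]; last by rewrite mulr0 mul0r.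
  by rewrite inE /N /= => ->; rewrite !mul0r.
move/ae_eq_integral_abs : LN0 => /(_ measurableT).
have mLN : measurable_fun setT (EFin \o (fun x => L x * \1_N (Z x) * prior x)).
  apply/measurable_EFinP; apply: measurable_funM => //.
  by apply: measurable_funM => //; exact: measurableT_comp.
move/(_ mLN); apply: filterS => x /(_ I) /= [LNx].
rewrite /P /Q /omega /posterior /approx_posterior /weight -/L -/a -/D -/(Z x).
have [az0|az0] := eqVneq (a (Z x)) 0.
  have : \1_N (Z x) = 1 :> R by rewrite indicE mem_set.
  by move=> N1; move: LNx; rewrite N1 mulr1 az0 => ->; rewrite !mul0r mulr0.
by field; rewrite az0 gt_eqF.
Qed.
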